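(* Let $N \ge 1$ and let $x_1,\ldots,x_N \in \mathbf{R}$. Consider the problem of finding $x^\ast \in \mathbf{R}$ such that $x^\ast = \arg\min_{x\in\mathbf{R}} \mathcal{L}(x)$. If there exists an index $t \in \{1,\ldots,N\}$ such that $$\left| N(x_t - \tilde x) + \frac{\Delta(x_t)}{2} \right| \leq \frac{\rho(x_t)}{2},$$ then $x^\ast = x_t$ is the solution to this problem, i.e. the point of $\mathbf{R}$ at which $\mathcal{L}$ attains its minimum over $\mathbf{R}$. If no such index exists, then the solution $x^\ast$ to this problem is the solution $x^\ast\in\mathbf{R}$ to the equation $$x^\ast + \frac{\Delta(x^\ast)}{2N} = \tilde x.$$
   Context: For given real numbers $x_1,\ldots,x_N$ (not necessarily distinct or sorted), define the following. - Cost function: $\mathcal{L}(x) = \sum_{i=1}^N f(|x-x_i|)$ for $x\in\mathbf{R}$, where $f(d) = \frac{d(d+1)}{2}$; that is, $\mathcal{L}(x) = \frac12\sum_{i=1}^N \left[(x-x_i)^2 + |x-x_i|\right]$. - Mean: $\tilde x = \frac1N\sum_{i=1}^N x_i$. - Count imbalance: $\Delta(x) = \#\{i : x_i < x\} - \#\{i : x_i > x\}$ for $x\in\mathbf{R}$. - Count multiplicity: $\rho(x) = \#\{i : x_i = x\}$ for $x\in\mathbf{R}$. Here $\#$ counts indices $i\in\{1,\ldots,N\}$. *)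

(* Defs.v *)
From mathcomp Require Import all_boot all_order all_algebra.
From mathcomp Require Import reals.

Set Implicit Arguments.
Unset Strict Implicit.
Unset Printing Implicit Defensive.

Import Order.TTheory GRing.Theory Num.Theory.
Local Open Scope ring_scope.

Definition pair_cost (R : realType) (d : R) : R := d * (d + 1) / 2.

Definition cost (R : realType) (N : nat) (x : 'I_N -> R) (z : R) : R :=
  \sum_(i < N) pair_cost `|z - x i|.

Definition mean (R : realType) (N : nat) (x : 'I_N -> R) : R :=
  N%:R^-1 * \sum_(i < N) x i.

(* The counts below are over indices, so repeated values are counted with
   multiplicity. *)
Definition imbalance (R : realType) (N : nat) (x : 'I_N -> R) (z : R) : int :=
  #|[pred i | x i < z]|%:Z - #|[pred i | x i > z]|%:Z.

Definition multiplicity (R : realType) (N : nat) (x : 'I_N -> R) (z : R) : nat :=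
  #|[pred i | x i == z]|.

(* [a = argmin g] with a point on the left-hand side: [a] is the one and only
   global minimizer of [g]. *)
Definition is_argmin (R : realType) (g : R -> R) (a : R) : Prop :=
  unique (fun z : R => forall y : R, g z <= g y) a.

(* Main.v *)
Require Import Defs.
From mathcomp Require Import all_boot all_order all_algebra.
From mathcomp Require Import reals.
From mathcomp Require Import ring lra.

Import Order.TTheory GRing.Theory Num.Theory.
Local Open Scope ring_scope.

(** The cost is the sum of the strictly convex quadratic [N (z - mean)^2 / 2]
    (up to a constant) and of the convex function [sum_i |z - x i| / 2], whose
    left and right derivatives at [z] are [(imbalance - multiplicity) / 2] and
    [(imbalance + multiplicity) / 2].  Hence [z] is the unique minimizer as soon
    as the left slope is [<= 0] and the right slope is [>= 0], which is the
    inequality of the theorem.  If this fails at every data point, the data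
    points with negative right slope lie below all the others; freezing
    this partition makes the slope affine, and its zero separates the two
    classes, so it is a genuine zero of the slope. *)

(** The sign [(-1) ^+ _] is the derivative of [|z - x i|]; a tie [z = x i] counts as [+1] here and
    as [-1] in [left_slope]. *)
Definition right_slope {R : realType} {N : nat} (x : 'I_N -> R) (z : R) : R :=
  \sum_(i < N) (z - x i + (-1) ^+ (z < x i)%R / 2).

Definition left_slope {R : realType} {N : nat} (x : 'I_N -> R) (z : R) : R :=
  \sum_(i < N) (z - x i + (-1) ^+ (z <= x i)%R / 2).

Section Slopes.
Context {R : realType} {N : nat} (x : 'I_N -> R).

Lemma natr_card_sum (P : pred 'I_N) :
  #|[pred i | P i]|%:R = \sum_(i < N) (P i)%:R :> R.
Proof.
rewrite -sum1_card natr_sum big_mkcond; apply: eq_bigr => i _.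
by rewrite inE; case: (P i).
Qed.

Lemma mulr_natl_sum (u : R) : N%:R * u = \sum_(i < N) u.
Proof. by rewrite sumr_const card_ord mulr_natl. Qed.

Lemma sum_sub_mean (z : R) : (0 < N)%N ->
  N%:R * (z - mean x) = \sum_(i < N) (z - x i).
Proof.
move=> N_gt0; rewrite sumrB sumr_const card_ord /mean mulrBr mulVKf ?mulr_natl//.
by rewrite pnatr_eq0 -lt0n.
Qed.

Lemma imbalanceE (z : R) :
  (imbalance x z)%:~R = \sum_(i < N) ((x i < z)%R%:R - (z < x i)%R%:R) :> R.
Proof.
by rewrite /imbalance intrB -!pmulrn !natr_card_sum sumrB.
Qed.

Lemma right_slopeE (z : R) : (0 < N)%N ->
  right_slope x z = N%:R * (z - mean x) + (imbalance x z)%:~R / 2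
                    + (multiplicity x z)%:R / 2.
Proof.
move=> N_gt0; rewrite sum_sub_mean// imbalanceE /multiplicity natr_card_sum.
rewrite !mulr_suml -!big_split; apply: eq_bigr => i _ /=.
by case: (ltgtP (x i) z) => _ /=; lra.
Qed.

Lemma left_slopeE (z : R) : (0 < N)%N ->
  left_slope x z = N%:R * (z - mean x) + (imbalance x z)%:~R / 2
                   - (multiplicity x z)%:R / 2.
Proof.
move=> N_gt0; rewrite sum_sub_mean// imbalanceE /multiplicity natr_card_sum.
rewrite !mulr_suml -sumrN -!big_split; apply: eq_bigr => i _ /=.
by case: (ltgtP (x i) z) => _ /=; lra.
Qed.

Lemma norm_le_slopes (z : R) : (0 < N)%N ->
  (`|N%:R * (z - mean x) + (imbalance x z)%:~R / 2|
     <= (multiplicity x z)%:R / 2) = (left_slope x z <= 0 <= right_slope x z).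
Proof.
move=> N_gt0; rewrite left_slopeE// right_slopeE// ler_norml.
by rewrite -[X in 0 <= _ + X]opprK subr_ge0 subr_le0 andbC.
Qed.

Lemma right_slope_homo : {homo right_slope x : y z / y <= z}.
Proof.
move=> y z yz; apply: ler_sum => i _.
by case: (ltP y (x i)) => ?; case: (ltP z (x i)) => ? /=; lra.
Qed.

Lemma pair_cost_norm (u : R) : pair_cost `|u| = (u ^+ 2 + `|u|) / 2.
Proof. by rewrite /pair_cost mulrDr mulr1 -expr2 real_normK ?num_real. Qed.

(** The square expands exactly around [z], leaving the remainder [(y - z) ^+ 2 / 2]; the absolute
    value lies above its right tangent at [z]. *)
Lemma pair_cost_ge_right (a z y : R) : z <= y ->
  (y - z) * (z - a + (-1) ^+ (z < a)%R / 2) + (y - z) ^+ 2 / 2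
    <= pair_cost `|y - a| - pair_cost `|z - a|.
Proof.
by move=> zy; rewrite !pair_cost_norm; case: (ltP z a) => ? /=;
  case: (ler0P (y - a)) => ?; case: (ler0P (z - a)) => ? /=; lra.
Qed.

Lemma pair_cost_ge_left (a z y : R) : y <= z ->
  (y - z) * (z - a + (-1) ^+ (z <= a)%R / 2) + (y - z) ^+ 2 / 2
    <= pair_cost `|y - a| - pair_cost `|z - a|.
Proof.
by move=> zy; rewrite !pair_cost_norm; case: (leP z a) => ? /=;
  case: (ler0P (y - a)) => ?; case: (ler0P (z - a)) => ? /=; lra.
Qed.

(** On either side of [z] the first-order term is nonnegative by the sign of the matching slope, so
    only the quadratic remainders count. They give uniqueness as well as minimality. *)
Lemma cost_quadratic_growth (z y : R) :
  left_slope x z <= 0 <= right_slope x z ->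
  N%:R * ((y - z) ^+ 2 / 2) <= cost x y - cost x z.
Proof.
move=> /andP[sl sr]; rewrite /cost -sumrB.
case: (leP z y) => [zy|/ltW yz].
- apply: (@le_trans _ _ ((y - z) * right_slope x z + N%:R * ((y - z) ^+ 2 / 2))).
    by rewrite lerDr mulr_ge0// subr_ge0.
  rewrite mulr_sumr mulr_natl_sum -big_split.
  by apply: ler_sum => i _; apply: pair_cost_ge_right.
- apply: (@le_trans _ _ ((y - z) * left_slope x z + N%:R * ((y - z) ^+ 2 / 2))).
    by rewrite lerDr mulr_le0// subr_le0.
  rewrite mulr_sumr mulr_natl_sum -big_split.
  by apply: ler_sum => i _; apply: pair_cost_ge_left.
Qed.

Lemma is_argmin_slopes (z : R) : (0 < N)%N ->
  left_slope x z <= 0 <= right_slope x z -> is_argmin (cost x) z.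
Proof.
move=> N_gt0 sz; split=> [y|w wmin].
  rewrite -subr_ge0; apply: le_trans (cost_quadratic_growth z y sz).
  by rewrite mulr_ge0// divr_ge0// sqr_ge0.
have := cost_quadratic_growth z w sz; have := wmin z; rewrite -subr_le0.
move=> /[swap] /le_trans/[apply].
rewrite pmulr_rle0 ?ltr0n// pmulr_lle0 ?invr_gt0//.
by rewrite le_eqVlt ltNge sqr_ge0 orbF sqrf_eq0 subr_eq0 => /eqP.
Qed.

Lemma slope_zero : (0 < N)%N ->
  (forall t, ~~ (left_slope x (x t) <= 0 <= right_slope x (x t))) ->
  exists z, left_slope x z = 0 /\ right_slope x z = 0.
Proof.
move=> N_gt0 noslope; pose below := [pred i | right_slope x (x i) < 0].
pose line z := \sum_(i < N) (z - x i + (-1) ^+ (i \notin below) / 2).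
have lineE z : line z = N%:R * z + line 0.
  rewrite mulr_natl_sum -big_split.
  by apply: eq_bigr => i _ /=; rewrite sub0r addrA.
have NR_gt0 : 0 < N%:R :> R by rewrite ltr0n.
pose z := - line 0 / N%:R.
have linez : line z = 0 by rewrite lineE /z mulrC divfK ?gt_eqF// addNr.
have line_lt y w : (line y < line w) = (y < w).
  by rewrite (lineE y) (lineE w) ltrD2r ltr_pM2l.
have below_closed i j : x i <= x j -> j \in below -> i \in below.
  by move=> /right_slope_homo; apply: le_lt_trans.
have lt_z i : i \in below -> x i < z.
  move=> i_below; case: (arg_maxP x i_below) => a a_below a_max.
  apply: le_lt_trans (a_max i i_below) _; rewrite -line_lt linez.
  suff -> : line (x a) = right_slope x (x a) by [].
  apply: eq_bigr => j _; congr (_ + (-1) ^+ nat_of_bool _ / 2).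
  rewrite ltNge; congr negb; apply/idP/idP => [/a_max//|xja].
  exact: below_closed xja a_below.
(* At the smallest point outside [below], [line] equals [left_slope]. The right slope is nonnegative
   there, so [noslope] forces the left one to be positive. *)
have gt_z i : i \notin below -> z < x i.
  move=> i_above; case: (@arg_minP _ _ _ i (fun i => i \notin below) x i_above).
  move=> b b_above b_min.
  apply: lt_le_trans (b_min i i_above); rewrite -line_lt linez.
  suff -> : line (x b) = left_slope x (x b).
    have := noslope b; rewrite negb_and -!ltNge => /orP[//|b_below].
    by rewrite inE b_below in b_above.
  apply: eq_bigr => j _; congr (_ + (-1) ^+ nat_of_bool _ / 2).
  apply/idP/idP => [/b_min//|xbj].
  by apply: contra b_above; apply: below_closed.
exists z; split; rewrite -linez; apply: eq_bigr => i _;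
  congr (_ + (-1) ^+ nat_of_bool _ / 2).
  case: (boolP (i \in below)) => [/lt_z|/gt_z/ltW//].
  by rewrite ltNge => /negbTE.
by case: (boolP (i \in below)) => [/lt_z/ltW|/gt_z//]; rewrite leNgt => /negbTE.
Qed.

End Slopes.

Theorem theorem1 (R : realType) (N : nat) (hN : (1 <= N)%N) (x : 'I_N -> R) :
  (forall t : 'I_N,
     `|N%:R * (x t - mean x) + (imbalance x (x t))%:~R / 2|
       <= (multiplicity x (x t))%:R / 2 ->
     is_argmin (cost x) (x t))
  /\
  (~ (exists t : 'I_N,
        `|N%:R * (x t - mean x) + (imbalance x (x t))%:~R / 2|
          <= (multiplicity x (x t))%:R / 2) ->
   exists xs : R,
     is_argmin (cost x) xs /\
     unique (fun z : R => z + (imbalance x z)%:~R / (2 * N%:R) = mean x) xs).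
Proof.
split=> [t|nt]; first by rewrite norm_le_slopes//; apply: is_argmin_slopes.
have [|z [sl sr]] := slope_zero x hN.
  by move=> t; apply/negP; rewrite -norm_le_slopes// => ht; apply: nt; exists t.
have NR_neq0 : N%:R != 0 :> R by rewrite pnatr_eq0 -lt0n.
have balance w : w + (imbalance x w)%:~R / (2 * N%:R) - mean x
    = (N%:R * (w - mean x) + (imbalance x w)%:~R / 2) / N%:R by field.
have zmin : is_argmin (cost x) z by apply: is_argmin_slopes; rewrite // sl sr lexx.
exists z; split=> //; split=> [|w /eqP].
  apply/eqP; rewrite -subr_eq0 balance mulf_eq0; apply/orP; left; apply/eqP.
  by move: sl sr; rewrite left_slopeE// right_slopeE//; lra.
rewrite -subr_eq0 balance mulf_eq0 invr_eq0 (negbTE NR_neq0) orbF => /eqP w0.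
(* A root of the equation makes the norm zero, so the inequality holds at [w], and uniqueness of the
   minimizer applies. *)
have wmin : is_argmin (cost x) w.
  by apply: is_argmin_slopes; rewrite // -norm_le_slopes// w0 normr0 divr_ge0.
by apply: (proj2 zmin); apply: (proj1 wmin).
Qed.
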